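(* Let $(X,d)$ be a compact metric space, $(X,f_{1,\infty})$ a nonautonomous dynamical system, and $K$ a nonempty $f_{1,\infty}$-invariant subset of $X$. Then $$D(f_{1,\infty},K)\le\underline{D}_K(f_{1,\infty})\le\overline{D}_K(f_{1,\infty}).$$
   Context: A nonautonomous dynamical system $(X,f_{1,\infty})$ consists of a compact space $X$ and a sequence $f_{1,\infty}=(f_i)_{i\ge 1}$ of continuous maps $f_i:X\to X$. Put $f_1^0=\mathrm{id}_X$, $f_1^j=f_j\circ\cdots\circ f_1$, and let $f_1^{-j}(A)=(f_1^j)^{-1}(A)$ denote preimages. A subset $K\subseteq X$ is $f_{1,\infty}$-invariant if $f_i^{-1}(K)=K$ for all $i\ge 1$. Classical quantities. For a finite open cover $\mathcal{U}$ of $X$ let $\mathcal{U}_1^n$ be the cover of all sets $\bigcap_{j=0}^{n-1}f_1^{-j}(U_j)$ with $U_j\in\mathcal{U}$, and let $\mathcal{N}(\mathcal{U}_1^n|_K)$ be the minimal number of members of $\{V\cap K: V\in\mathcal{U}_1^n\}$ needed to cover $K$. For $s>0$ set $\overline{h}_K(f_{1,\infty},s)=\sup_{\mathcal{U}}\limsup_{n\to\infty}\frac{1}{n^s}\log\mathcal{N}(\mathcal{U}_1^n|_K)$ and $\underline{h}_K(f_{1,\infty},s)=\sup_{\mathcal{U}}\liminf_{n\to\infty}\frac{1}{n^s}\log\mathcal{N}(\mathcal{U}_1^n|_K)$, suprema over all finite open covers of $X$. The upper and lower topological entropy dimensions are $\overline{D}_K(f_{1,\infty})=\inf\{s>0:\overline{h}_K(f_{1,\infty},s)=0\}=\sup\{s>0:\overline{h}_K(f_{1,\infty},s)=\infty\}$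 and $\underline{D}_K(f_{1,\infty})=\inf\{s>0:\underline{h}_K(f_{1,\infty},s)=0\}=\sup\{s>0:\underline{h}_K(f_{1,\infty},s)=\infty\}$. Pesin quantities. For a finite open cover $\mathcal{U}$ of $X$, let $S(\mathcal{U})$ be the set of all finite strings $\mathbf{U}=(U_{i_0},\dots,U_{i_{m-1}})$ of elements of $\mathcal{U}$, with length $m(\mathbf{U})=m$, and let $X(\mathbf{U})=\{x\in X: f_1^j(x)\in U_{i_j},\ 0\le j\le m(\mathbf{U})-1\}$. A collection $\mathcal{G}\subseteq S(\mathcal{U})$ covers $K$ if $K\subseteq\bigcup_{\mathbf{U}\in\mathcal{G}}X(\mathbf{U})$. For $\alpha\in\mathbb{R}$, $s>0$ let $M(f_{1,\infty},K,s,\mathcal{U},\alpha,N)=\inf_{\mathcal{G}}\sum_{\mathbf{U}\in\mathcal{G}}e^{-\alpha m(\mathbf{U})^s}$, the infimum over all finite or countable $\mathcal{G}\subseteq S(\mathcal{U})$ covering $K$ with $m(\mathbf{U})\ge N$ for all $\mathbf{U}\in\mathcal{G}$. Let $m(f_{1,\infty},K,s,\mathcal{U},\alpha)=\lim_{N\to\infty}M(f_{1,\infty},K,s,\mathcal{U},\alpha,N)$, $D(f_{1,\infty},K,s,\mathcal{U})=\inf\{\alpha: m(f_{1,\infty},K,s,\mathcal{U},\alpha)=0\}=\sup\{\alpha: m(f_{1,\infty},K,s,\mathcal{U},\alpha)=\infty\}$, and $D(f_{1,\infty},K,s)=\sup_{\mathcal{U}}D(f_{1,\infty},K,s,\mathcal{U})$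 over finite open covers $\mathcal{U}$ of $X$. The Pesin topological entropy dimension is $D(f_{1,\infty},K)=\sup\{s>0:D(f_{1,\infty},K,s)=+\infty\}=\inf\{s>0:D(f_{1,\infty},K,s)=0\}$. Conventions for sets of $s>0$: $\inf\emptyset=+\infty$, $\sup\emptyset=0$. *)

(* Defs.v *)
From HB Require Import structures.
From mathcomp Require Import all_boot all_order all_algebra.
From mathcomp Require Import all_classical all_reals all_analysis.

Set Implicit Arguments.
Unset Strict Implicit.
Unset Printing Implicit Defensive.

Import Order.TTheory GRing.Theory Num.Theory.
Import numFieldNormedType.Exports.

Local Open Scope classical_set_scope.
Local Open Scope ring_scope.

(* A sequence (f_i)_{i >= 1} of self-maps is encoded as [f : nat -> X -> X];
   the value [f 0] is never used. *)
Definition nonautonomous_ds (X : topologicalType) (f : nat -> X -> X) : Prop :=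
  forall i, (1 <= i)%N -> continuous (f i).

(* [orbit_map f j] is f_1^j = f_j \o ... \o f_1. *)
Fixpoint orbit_map (X : Type) (f : nat -> X -> X) (j : nat) : X -> X :=
  if j is k.+1 then f k.+1 \o orbit_map f k else id.

Definition invariant_set (X : Type) (f : nat -> X -> X) (K : set X) : Prop :=
  forall i, (1 <= i)%N -> f i @^-1` K = K.

Definition finite_open_cover (X : topologicalType) (U : set (set X)) : Prop :=
  [/\ finite_set U, U `<=` open & \bigcup_(A in U) A = [set: X]].

(* inf and sup in [0, +oo] of a set of positive reals, with inf set0 = +oo
   (which is what [ereal_inf] gives) and sup set0 = 0 (whence the extra 0, as
   [ereal_sup set0] is -oo). *)
Definition inf_pos (R : realType) (A : set R) : \bar R :=
  ereal_inf (EFin @` A).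

Definition sup_pos (R : realType) (A : set R) : \bar R :=
  ereal_sup (0%:E |` (EFin @` A)).

Definition joined_cover (X : Type) (f : nat -> X -> X) (U : set (set X))
    (n : nat) : set (set X) :=
  [set V | exists2 u : nat -> set X, (forall j, (j < n)%N -> U (u j)) &
           V = \bigcap_(j in `I_n) (orbit_map f j @^-1` u j)].

Definition covered_by (X : Type) (W : set (set X)) (K : set X) (k : nat) :
    Prop :=
  exists C : set (set X), [/\ C `<=` [set V `&` K | V in W],
    (C #= `I_k)%card & K `<=` \bigcup_(A in C) A].

(* The least k such that [covered_by W K k]; the default value 0 is irrelevant
   here, as [joined_cover f U n] is a finite cover of X whenever U is. *)
Definition min_cover_number (X : Type) (W : set (set X)) (K : set X) : nat :=
  xget 0%N [set k | covered_by W K k /\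
                    forall l, covered_by W K l -> (k <= l)%N].

Definition log_growth (R : realType) (X : Type) (f : nat -> X -> X)
    (K : set X) (s : R) (U : set (set X)) (n : nat) : \bar R :=
  (ln (min_cover_number (joined_cover f U n) K)%:R / (n%:R `^ s))%:E.

Definition upper_entropy (R : realType) (X : topologicalType)
    (f : nat -> X -> X) (K : set X) (s : R) : \bar R :=
  ereal_sup [set limn_esup (log_growth f K s U) | U in @finite_open_cover X].

Definition lower_entropy (R : realType) (X : topologicalType)
    (f : nat -> X -> X) (K : set X) (s : R) : \bar R :=
  ereal_sup [set limn_einf (log_growth f K s U) | U in @finite_open_cover X].

(* Where a quantity has two equal expressions (an inf over vanishing values and
   a sup over infinite values, equal for nonempty K), the definitions below take
   inf for the classical dimensions and for [pesin_cover_entropy], and sup for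
   [pesin_entropy_dim]. *)
Definition upper_entropy_dim (R : realType) (X : topologicalType)
    (f : nat -> X -> X) (K : set X) : \bar R :=
  inf_pos [set s : R | 0 < s /\ upper_entropy f K s = 0%:E].

Definition lower_entropy_dim (R : realType) (X : topologicalType)
    (f : nat -> X -> X) (K : set X) : \bar R :=
  inf_pos [set s : R | 0 < s /\ lower_entropy f K s = 0%:E].

Definition strings (X : Type) (U : set (set X)) : set (seq (set X)) :=
  [set u | forall j, (j < size u)%N -> U (nth set0 u j)].

Definition string_set (X : Type) (f : nat -> X -> X) (u : seq (set X)) :
    set X :=
  [set x | forall j, (j < size u)%N -> (nth set0 u j) (orbit_map f j x)].

Definition pesin_families (X : Type) (f : nat -> X -> X) (K : set X)
    (U : set (set X)) (N : nat) : set (set (seq (set X))) :=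
  [set G | [/\ countable G, G `<=` strings U,
               K `<=` \bigcup_(u in G) string_set f u &
               forall u, G u -> (N <= size u)%N]].

Definition pesin_M (R : realType) (X : Type) (f : nat -> X -> X) (K : set X)
    (s : R) (U : set (set X)) (alpha : R) (N : nat) : \bar R :=
  ereal_inf [set (\esum_(u in G) (expR (- alpha * (size u)%:R `^ s))%:E)%E
            | G in pesin_families f K U N].

Definition pesin_m (R : realType) (X : Type) (f : nat -> X -> X) (K : set X)
    (s : R) (U : set (set X)) (alpha : R) : \bar R :=
  limn (pesin_M f K s U alpha).

Definition pesin_cover_entropy (R : realType) (X : Type) (f : nat -> X -> X)
    (K : set X) (s : R) (U : set (set X)) : \bar R :=
  ereal_inf (EFin @` [set alpha : R | pesin_m f K s U alpha = 0%:E]).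

Definition pesin_entropy (R : realType) (X : topologicalType)
    (f : nat -> X -> X) (K : set X) (s : R) : \bar R :=
  ereal_sup [set pesin_cover_entropy f K s U | U in @finite_open_cover X].

Definition pesin_entropy_dim (R : realType) (X : topologicalType)
    (f : nat -> X -> X) (K : set X) : \bar R :=
  sup_pos [set s : R | 0 < s /\ pesin_entropy f K s = +oo%E].

(* Main.v *)
Require Import Defs.
From HB Require Import structures.
From mathcomp Require Import all_boot all_order all_algebra.
From mathcomp Require Import all_classical all_reals all_analysis.
From mathcomp Require Import lra.

(** The second inequality holds because a lower limit is at most the upper
    limit, so that every exponent at which the upper entropy vanishes is one at
    which the (nonnegative) lower entropy vanishes.

    For the first inequality, fix a finite open cover U and an exponent s > 0.
    A member of the joined cover U_1^n is exactly the set X(u) of a string u of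
    length n, so a minimal subcover of K by U_1^n is an admissible family in the
    definition of M(f, K, s, U, alpha, N) for every n >= N. All its strings have
    the same length, so its cost is N_n * exp(- alpha * n^s), where N_n is the
    covering number: this is [pesin_M_le_cover_number]. If the lower limit of
    log N_n / n^s is less than b < alpha, then N_n <= exp(b * n^s) for
    arbitrarily large n, and the cost is at most exp(- (alpha - b) * n^s) for
    these n. Hence M vanishes for every N ([pesin_m_eq0]), and the Pesin entropy
    of exponent s is at most the lower entropy of exponent s
    ([pesin_entropy_le_lower]).

    As the lower entropy decreases with the exponent
    ([lower_entropy_antitone]), it is zero at every s above an exponent t where
    it vanishes; the Pesin entropy is then finite at s, so every exponent with
    infinite Pesin entropy is at most t. *)

Set Implicit Arguments.
Unset Strict Implicit.
Unset Printing Implicit Defensive.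

Local Open Scope classical_set_scope.
Local Open Scope ring_scope.

Import Order.TTheory GRing.Theory Num.Theory.

(** * Lower limits and exponential decay *)

Lemma limn_einf_frequently_lt (R : realType) (u : (\bar R)^nat) (b : \bar R)
    (N : nat) :
  (limn_einf u < b)%E -> exists2 n, (N <= n)%N & (u n < b)%E.
Proof.
rewrite limn_einf_lim (cvg_lim _ (@cvg_einfs_sup _ u))// => ub.
have : (einfs u N < b)%E.
  by apply: le_lt_trans ub; apply: ereal_sup_ubound; exists N.
by move=> /ereal_inf_lt[_ [n /= Nn <-] unb]; exists n.
Qed.

Lemma le_limn_einf (R : realType) (u v : (\bar R)^nat) :
  (forall n, (u n <= v n)%E) -> (limn_einf u <= limn_einf v)%E.
Proof.
move=> uv; rewrite !limn_einf_lim; apply: lee_lim; [exact: is_cvg_einfs..|].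
apply: nearW => n; apply: le_ereal_inf_tmp => _ [m nm <-].
by apply: le_trans (uv m); apply: ereal_inf_lbound; exists m.
Qed.

(** Only an upper bound on the cardinality of [G] is assumed: the strings coding
    the members of a cover need not be pairwise distinct. *)
Lemma esum_cst_le (R : realType) (T : choiceType) (G : set T) (k : nat)
    (a : T -> \bar R) (c : R) :
  (G #<= `I_k)%card -> 0 <= c -> (forall x, G x -> a x = c%:E) ->
  (\esum_(x in G) a x <= (k%:R * c)%:E)%E.
Proof.
move=> Gk c0 aE.
have finG : finite_set G by apply/finite_set_leP; exists k.
rewrite (eq_esum aE) esum_fset// fsbig_finite//= sumEFin big_const_seq count_predT.
rewrite iter_addr_0 lee_fin -[leLHS]mulr_natl ler_wpM2r//.
by rewrite ler_nat geq_card_fset_set.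
Qed.

(** A quantity that does not depend on n but is bounded by exp(- c n^s) along a
    sequence of n tending to infinity cannot be positive. *)
Lemma frequently_decay_le0 (R : realType) (s c : R) (x : \bar R) :
  0 < s -> 0 < c ->
  (forall N, exists2 n, (N <= n)%N & (x <= (expR (- c * n%:R `^ s))%:E)%E) ->
  (x <= 0)%E.
Proof.
move=> s0 c0 xe; apply/lee_addgt0Pr => e e0; rewrite add0e.
(* exp(- c n^s) <= e as soon as n^s >= - ln e / c; the maximum with 0 allows
   taking an s-th root when e > 1. *)
pose y := Num.max 0 (- ln e / c).
have [n Nn /le_trans] := xe (Num.truncn (y `^ s^-1)).+1; apply.
have y0 : 0 <= y by rewrite le_max lexx.
have yn : y <= n%:R `^ s.
  have -> : y = (y `^ s^-1) `^ s by rewrite -powRrM mulVf ?powRr1 ?gt_eqF.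
  apply: ge0_ler_powR; rewrite ?nnegrE ?powR_ge0//; first exact: ltW.
  by rewrite (le_trans (ltW (truncnS_gt _)))// ler_nat.
rewrite lee_fin -[leRHS]lnK ?posrE// ler_expR.
have : - ln e / c <= n%:R `^ s by apply: le_trans yn; rewrite le_max lexx orbT.
by rewrite ler_pdivrMr// mulrC mulNr lerNl.
Qed.

(** * Joined covers and their covering numbers *)

(** The dictionary between the two theories: intersections of preimages along
    the orbit are cylinders of strings. *)
Lemma joined_cover_string (X : Type) (f : nat -> X -> X) (U : set (set X))
    (n : nat) (V : set X) :
  joined_cover f U n V ->
  exists u, [/\ strings U u, size u = n & V = string_set f u].
Proof.
move=> [u uU ->]; exists (mkseq u n); split; last 1 first.
- apply/seteqP; split=> x ux j /=; rewrite ?size_mkseq => jn.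
    by rewrite nth_mkseq//; exact: ux.
  by have := ux j; rewrite size_mkseq nth_mkseq//; apply.
- by move=> j; rewrite size_mkseq => jn; rewrite nth_mkseq//; exact: uU.
- by rewrite size_mkseq.
Qed.

Lemma joined_cover_finite (X : Type) (f : nat -> X -> X) (U : set (set X))
    (n : nat) :
  finite_set U -> finite_set (joined_cover f U n).
Proof.
move=> finU; elim: n => [|n IHn].
  apply: (sub_finite_set _ (finite_set1 [set: X])) => _ [u _ ->] /=.
  by apply/seteqP; split.
apply: (sub_finite_set _
  (finite_image2 (fun A B => A `&` orbit_map f n @^-1` B) IHn finU)).
move=> _ [u uU ->] /=.
exists (\bigcap_(j in `I_n) (orbit_map f j @^-1` u j)).
  by exists u => // j jn; exact/uU/ltnW.
exists (u n); first exact: uU.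
by rewrite [in RHS]IIS bigcap_setU bigcap_set1.
Qed.

Lemma joined_cover_covers (X : Type) (f : nat -> X -> X) (U : set (set X))
    (n : nat) :
  \bigcup_(A in U) A = [set: X] ->
  \bigcup_(V in joined_cover f U n) V = [set: X].
Proof.
move=> Ucov; apply/seteqP; split=> // x _.
have memU j : exists A, U A /\ A (orbit_map f j x).
  have : (\bigcup_(A in U) A) (orbit_map f j x) by rewrite Ucov.
  by move=> [A UA Ax]; exists A.
have [u uP] := choice memU.
exists (\bigcap_(j in `I_n) (orbit_map f j @^-1` u j)).
  by exists u => // j _; have [] := uP j.
by move=> j _ /=; have [] := uP j.
Qed.

(** The default value in the definition of the covering number is never reached:
    a finite cover is its own subcover, so the minimum exists. *)
Lemma min_cover_numberP (X : Type) (W : set (set X)) (K : set X) :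
  finite_set W -> K `<=` \bigcup_(V in W) V ->
  Defs.covered_by W K (min_cover_number W K).
Proof.
move=> finW KW.
have exk : exists k, `[< Defs.covered_by W K k >].
  have /finite_setP[k Wk] := finite_image (fun V => V `&` K) finW.
  exists k; apply/asboolP; exists [set V `&` K | V in W]; split=> // x Kx.
  have [V WV Vx] := KW x Kx.
  by exists (V `&` K) => //; exists V.
have minex : exists k, Defs.covered_by W K k /\
    forall l, Defs.covered_by W K l -> (k <= l)%N.
  have [k /asboolP Wk kmin] := ex_minnP exk.
  by exists k; split=> // l /asboolP; exact: kmin.
by have [] := xgetPex 0%N minex.
Qed.

(** * Pesin sums against covering numbers *)

Lemma pesin_M_ge0 (R : realType) (X : Type) (f : nat -> X -> X) (K : set X)
    (s : R) (U : set (set X)) (alpha : R) (N : nat) :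
  (0 <= pesin_M f K s U alpha N)%E.
Proof.
apply: le_ereal_inf_tmp => _ [G _ <-].
by apply: esum_ge0 => u _; rewrite lee_fin expR_ge0.
Qed.

(** A minimal subcover by U_1^n, coded by strings of length n, is one of the
    families over which the infimum is taken. *)
Lemma pesin_M_le_cover_number (R : realType) (X : Type) (f : nat -> X -> X)
    (K : set X) (s : R) (U : set (set X)) (alpha : R) (N n : nat) :
  finite_set U -> \bigcup_(A in U) A = [set: X] -> (N <= n)%N ->
  (pesin_M f K s U alpha N <=
   ((min_cover_number (joined_cover f U n) K)%:R *
    expR (- alpha * n%:R `^ s))%:E)%E.
Proof.
move=> finU Ucov Nn.
have : K `<=` \bigcup_(V in joined_cover f U n) V by rewrite joined_cover_covers.
move=> /(@min_cover_numberP _ _ _ (joined_cover_finite f n finU)).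
set k := min_cover_number _ _ => -[C [CW Ck KC]].
have codeC A : exists u, C A ->
    [/\ strings U u, size u = n & A `<=` string_set f u].
  have [/CW[V /joined_cover_string[u [uU un Vu]] <-]|nCA] := pselect (C A).
    by exists u => _; split=> //; rewrite -Vu; exact: subIsetl.
  by exists [::].
have [h hP] := choice codeC.
apply: (@le_trans _ _
    (\esum_(u in h @` C) (expR (- alpha * (size u)%:R `^ s))%:E)%E).
  apply: ereal_inf_lbound; exists (h @` C) => //; split.
  - apply/finite_set_countable/finite_image/finite_setP.
    by exists k.
  - by move=> _ [A CA <-]; have [] := hP A CA.
  - move=> x /KC[A CA Ax]; exists (h A); first by exists A.
    by have [_ _] := hP A CA; apply.
  - by move=> _ [A CA <-]; have [_ -> _] := hP A CA.
apply: esum_cst_le; last 1 first.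
- by move=> _ [A CA <-]; have [_ -> _] := hP A CA.
- by move: Ck; rewrite card_eq_le => /andP[+ _]; exact/card_le_trans/card_image_le.
- exact: expR_ge0.
Qed.

(** Letting n run through the times at which N_n < exp(b n^s), the preceding
    bound becomes N_n exp(- alpha n^s) <= exp(- (alpha - b) n^s) --> 0 with N
    fixed, so already each M(f, K, s, U, alpha, N) is zero. *)
Lemma pesin_m_eq0 (R : realType) (X : Type) (f : nat -> X -> X)
    (K : set X) (s : R) (U : set (set X)) (b alpha : R) :
  0 < s -> finite_set U -> \bigcup_(A in U) A = [set: X] -> b < alpha ->
  (limn_einf (log_growth f K s U) < b%:E)%E ->
  pesin_m f K s U alpha = 0%E.
Proof.
move=> s0 finU Ucov ba growth.
suff M0 N : pesin_M f K s U alpha N = 0%E.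
  by rewrite /pesin_m (funext M0); exact: lim_cst.
apply/eqP; rewrite eq_le pesin_M_ge0 andbT.
apply: (@frequently_decay_le0 _ s (alpha - b)) => //; first by rewrite subr_gt0.
move=> N'.
(* The successor makes n positive, so that n^s > 0 can be cleared from the
   denominator. *)
have [n + ] := limn_einf_frequently_lt (maxn N N').+1 growth.
rewrite gtn_max => /andP[Nn N'n] growthn; exists n; first exact: ltnW.
apply: (le_trans (pesin_M_le_cover_number f K s alpha finU Ucov (ltnW Nn))).
move: growthn; rewrite /log_growth lte_fin lee_fin.
set k := (min_cover_number _ _).
have ns0 : 0 < n%:R `^ s :> R by rewrite powR_gt0// ltr0n (leq_ltn_trans _ Nn).
rewrite ltr_pdivrMr// => lnk.
have -> : - (alpha - b) * n%:R `^ s = b * n%:R `^ s + - alpha * n%:R `^ s.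
  by rewrite opprB mulrBl mulNr.
rewrite expRD ler_wpM2r ?expR_ge0//.
have [->|k0] := posnP k; first exact: expR_ge0.
by rewrite -[leLHS]lnK ?posrE ?ltr0n// ler_expR ltW.
Qed.

(** * Comparison of the entropies at a given exponent *)

Lemma ln_nat_ge0 (R : realType) (n : nat) : 0 <= ln (n%:R : R).
Proof. by case: n => [|n]; [rewrite ln0|rewrite ln_ge0// ler1n]. Qed.

Lemma log_growth_ge0 (R : realType) (X : Type) (f : nat -> X -> X)
    (K : set X) (s : R) (U : set (set X)) (n : nat) :
  (0 <= log_growth f K s U n)%E.
Proof.
by rewrite lee_fin divr_ge0 ?powR_ge0 ?ln_nat_ge0.
Qed.

Lemma limn_einf_log_growth_ge0 (R : realType) (X : Type) (f : nat -> X -> X)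
    (K : set X) (s : R) (U : set (set X)) :
  (0 <= limn_einf (log_growth f K s U))%E.
Proof.
rewrite leNgt; apply/negP => /(limn_einf_frequently_lt 0)[n _].
by rewrite ltNge log_growth_ge0.
Qed.

(** Every real alpha above the lower limit annihilates m(f, K, s, U, alpha), so
    the infimum of such alpha is at most that limit. *)
Lemma pesin_cover_entropy_le (R : realType) (X : Type) (f : nat -> X -> X)
    (K : set X) (s : R) (U : set (set X)) :
  0 < s -> finite_set U -> \bigcup_(A in U) A = [set: X] ->
  (pesin_cover_entropy f K s U <= limn_einf (log_growth f K s U))%E.
Proof.
move=> s0 finU Ucov; apply/lee_addgt0Pr => e e0.
have := limn_einf_log_growth_ge0 f K s U.
(* The value -oo is excluded by nonnegativity. *)
case L : (limn_einf _) => [r| |] // _; last by rewrite leey.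
apply: ereal_inf_lbound; exists (r + e) => //=.
by apply: (@pesin_m_eq0 _ _ _ _ _ _ (r + e / 2)) => //; rewrite ?L ?lte_fin; lra.
Qed.

Lemma pesin_entropy_le_lower (R : realType) (X : topologicalType)
    (f : nat -> X -> X) (K : set X) (s : R) :
  0 < s -> (pesin_entropy f K s <= lower_entropy f K s)%E.
Proof.
move=> s0; apply: ge_ereal_sup => _ [U covU <-].
have [finU _ Ucov] := covU.
apply: le_trans (pesin_cover_entropy_le f K s0 finU Ucov) _.
by apply: ereal_sup_ubound; exists U.
Qed.

Lemma lower_entropy_antitone (R : realType) (X : topologicalType)
    (f : nat -> X -> X) (K : set X) (t s : R) :
  0 < t -> t <= s -> (lower_entropy f K s <= lower_entropy f K t)%E.
Proof.
move=> t0 ts; apply: ge_ereal_sup => _ [U covU <-].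
apply: (@le_trans _ _ (limn_einf (log_growth f K t U))); last first.
  by apply: ereal_sup_ubound; exists U.
(* At n = 0 both quotients have denominator 0 `^ _ = 0, hence are 0; for n >= 1
   the power n^s increases with s. *)
apply: le_limn_einf => -[|n]; rewrite lee_fin.
  by rewrite !powR0 ?gt_eqF// (lt_le_trans t0).
rewrite ler_wpM2l ?ln_nat_ge0// lef_pV2 ?posrE ?powR_gt0//.
by rewrite ler_powR// ler1n.
Qed.

(** The trivial cover {X} bounds the supremum from below: without some cover the
    supremum would be -oo. *)
Lemma lower_entropy_ge0 (R : realType) (X : topologicalType)
    (f : nat -> X -> X) (K : set X) (s : R) : (0 <= lower_entropy f K s)%E.
Proof.
apply: (le_trans (limn_einf_log_growth_ge0 f K s [set setT])).
apply: ereal_sup_ubound; exists [set setT] => //; split=> //.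
- by move=> _ ->; exact: openT.
- exact: bigcup_set1.
Qed.

Lemma lower_le_upper_entropy (R : realType) (X : topologicalType)
    (f : nat -> X -> X) (K : set X) (s : R) :
  (lower_entropy f K s <= upper_entropy f K s)%E.
Proof.
apply: ge_ereal_sup => _ [U covU <-].
apply: le_trans (limn_einf_sup _) _.
by apply: ereal_sup_ubound; exists U.
Qed.

Theorem theorem4p2 (R : realType) (X : metricType R) (f : nat -> X -> X)
    (K : set X) (Xcompact : compact [set: X]) (fds : nonautonomous_ds f)
    (K0 : K !=set0) (Kinv : invariant_set f K) :
  (pesin_entropy_dim R f K <= lower_entropy_dim R f K)%E /\
  (lower_entropy_dim R f K <= upper_entropy_dim R f K)%E.
Proof.
split.
  apply: le_ereal_inf_tmp => _ [t [t0 lower0] <-].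
  apply: ge_ereal_sup => _ [->|[s [s0 pesinoo] <-]]; rewrite lee_fin.
    exact: ltW.
  rewrite leNgt; apply/negP => ts.
  have := pesin_entropy_le_lower f K s0.
  rewrite pesinoo leye_eq => /eqP loweroo.
  have := lower_entropy_antitone f K t0 (ltW ts).
  by rewrite lower0 loweroo leye_eq.
apply/ereal_inf_le_tmp/image_subset => s [s0 upper0]; split=> //.
apply/eqP; rewrite eq_le lower_entropy_ge0 andbT -upper0.
exact: lower_le_upper_entropy.
Qed.
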